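(* Let $k_1,k_2\ge1$ be integers and let $a,b,c_1,c_2,t_1,t_2\in\mathbb{C}$. The first discrete Appell function has the integral representations $$\mathcal{F}^{(1)}_4(a,b;c_1,c_2;t_1,t_2,k_1,k_2,x,y)=\frac{1}{\Gamma(a)}\int_0^\infty e^{-u}u^{a-1}\,G_b\big((-k_1)^{k_1}ux,\,(-k_2)^{k_2}uy\big)\,du$$ and $$\mathcal{F}^{(1)}_4(a,b;c_1,c_2;t_1,t_2,k_1,k_2,x,y)=\frac{1}{\Gamma(b)}\int_0^\infty e^{-u}u^{b-1}\,G_a\big((-k_1)^{k_1}ux,\,(-k_2)^{k_2}uy\big)\,du,$$ where, for $d\in\mathbb{C}$, $G_d$ is the Kampé de Fériet function $F^{1:k_1;k_2}_{0:1;1}$ with numerator parameters $d:\ \frac{-t_1}{k_1},\dots,\frac{-t_1+k_1-1}{k_1};\ \frac{-t_2}{k_2},\dots,\frac{-t_2+k_2-1}{k_2}$ and denominator parameters $-:\ c_1;\ c_2$, that is, $$G_d(X,Y)=\sum_{m,n\ge0}\frac{(d)_{m+n}\prod_{j=0}^{k_1-1}\left(\frac{-t_1+j}{k_1}\right)_m\prod_{j=0}^{k_2-1}\left(\frac{-t_2+j}{k_2}\right)_n}{(c_1)_m(c_2)_n}\,\frac{X^mY^n}{m!\,n!}.$$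
   Context: For $a\in\mathbb{C}$ the shifted factorial is $(a)_0=1$ and $(a)_l=a(a+1)\cdots(a+l-1)$ for $l\ge1$. For complex $a,b,c_1,c_2,t_1,t_2$ with $\Re(c_1),\Re(c_2)\ne 0,-1,-2,\dots$ and natural numbers $k_1,k_2$, the first discrete Appell function is $$\mathcal{F}^{(1)}_4(a,b;c_1,c_2;t_1,t_2,k_1,k_2,x,y)=\sum_{m,n\ge0}\frac{(a)_{m+n}(b)_{m+n}(-1)^{mk_1}(-t_1)_{mk_1}(-1)^{nk_2}(-t_2)_{nk_2}}{(c_1)_m(c_2)_n\,m!\,n!}\,x^my^n.$$ The series is regarded as an absolutely convergent function of its last two arguments $x,y$ in the region $\sqrt{|x|}+\sqrt{|y|}<1$. $\Gamma$ is the gamma function.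
   Formalization: The first representation is stated for Re(a)>0 and the second for Re(b)>0, since otherwise the integral diverges at u=0; x, y are points of the region where the series of the Appell function converges absolutely. *)

(* Defs.v *)
From Stdlib Require Import Reals List ZArith.
From Coquelicot Require Import Coquelicot.
Open Scope R_scope.

(* The shifted factorial (a)_l. *)
Fixpoint poch (a : C) (l : nat) : C :=
  match l with
  | O => RtoC 1
  | S l' => (poch a l' * (a + RtoC (INR l')))%C
  end.

Definition poch_list (ps : list C) (l : nat) : C :=
  fold_right Cmult (RtoC 1) (map (fun p => poch p l) ps).

Definition Cseries (f : nat -> C) : C :=
  (Series (fun n => Re (f n)), Series (fun n => Im (f n))).

(* [Series] returns a junk value on a divergent series, so every use of
   [Csum2] has to come with [abs_summable2]; for an absolutely summable family
   the iterated sum is the sum over all pairs (m, n), in any order. *)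
Definition abs_summable2 (f : nat -> nat -> C) : Prop :=
  (forall m : nat, ex_series (fun n => Cmod (f m n))) /\
  ex_series (fun m => Series (fun n => Cmod (f m n))).

Definition Csum2 (f : nat -> nat -> C) : C :=
  Cseries (fun m => Cseries (fun n => f m n)).

(* u^s = exp (s ln u), for u > 0 and a complex exponent s. *)
Definition Rcpow (u : R) (s : C) : C :=
  (exp (Re s * ln u) * cos (Im s * ln u), exp (Re s * ln u) * sin (Im s * ln u)).

(* Improper integrals over (0, +oo) of complex-valued functions; the lower
   bound also is a limit, the integrand being possibly singular at 0. The
   structures are given explicitly because the canonical ones on C have C, not
   R, as field of scalars. *)
Definition ex_CInt0 (f : R -> C) : Prop :=
  @ex_RInt_gen C_R_NormedModule f (at_right 0) (Rbar_locally p_infty).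

Definition CInt0 (f : R -> C) : C :=
  @RInt_gen C_R_CompleteNormedModule f (at_right 0) (Rbar_locally p_infty).

(* Euler's integral for Re z > 0, continued to the other half-plane by
   Gamma z = Gamma (z + N) / (z)_N, where N is the least natural number such
   that Re z + N > 0 (N = 0 when Re z > 0). *)
Definition Gamma_Euler (z : C) : C :=
  CInt0 (fun u => RtoC (exp (- u)) * Rcpow u (z - RtoC 1))%C.

Definition Gamma (z : C) : C :=
  let N := Z.to_nat (up (- Re z)) in
  (Gamma_Euler (z + RtoC (INR N)) / poch z N)%C.

Definition F4_1_term (a b c1 c2 t1 t2 : C) (k1 k2 : nat) (x y : C)
    (m n : nat) : C :=
  ((poch a (m + n) * poch b (m + n)
    * (RtoC (-1) ^ (m * k1) * poch (- t1) (m * k1))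
    * (RtoC (-1) ^ (n * k2) * poch (- t2) (n * k2)))
   / (poch c1 m * poch c2 n * RtoC (INR (fact m)) * RtoC (INR (fact n)))
   * x ^ m * y ^ n)%C.

(* The first discrete Appell function. *)
Definition F4_1 (a b c1 c2 t1 t2 : C) (k1 k2 : nat) (x y : C) : C :=
  Csum2 (F4_1_term a b c1 c2 t1 t2 k1 k2 x y).

(* The Kampe de Feriet function with numerator parameters  A : B ; B'  and
   denominator parameters  D : E ; E'. *)
Definition KdF_term (A B B' D E E' : list C) (X Y : C) (m n : nat) : C :=
  ((poch_list A (m + n) * poch_list B m * poch_list B' n)
   / (poch_list D (m + n) * poch_list E m * poch_list E' n)
   * (X ^ m * Y ^ n / (RtoC (INR (fact m)) * RtoC (INR (fact n)))))%C.

Definition KdF (A B B' D E E' : list C) (X Y : C) : C :=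
  Csum2 (KdF_term A B B' D E E' X Y).

(* The k numerator parameters (-t + j) / k, j = 0, ..., k - 1. *)
Definition split_params (t : C) (k : nat) : list C :=
  map (fun j => ((- t + RtoC (INR j)) / RtoC (INR k))%C) (seq 0 k).

Definition G_term (d c1 c2 t1 t2 : C) (k1 k2 : nat) (X Y : C) :
    nat -> nat -> C :=
  KdF_term (d :: nil) (split_params t1 k1) (split_params t2 k2)
           nil (c1 :: nil) (c2 :: nil) X Y.

Definition G (d c1 c2 t1 t2 : C) (k1 k2 : nat) (X Y : C) : C :=
  KdF (d :: nil) (split_params t1 k1) (split_params t2 k2)
      nil (c1 :: nil) (c2 :: nil) X Y.

(* (-k)^k u z *)
Definition scaled_arg (k : nat) (u : R) (z : C) : C :=
  ((- RtoC (INR k)) ^ k * RtoC u * z)%C.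

Definition G_integrand (s d c1 c2 t1 t2 : C) (k1 k2 : nat) (x y : C)
    (u : R) : C :=
  (RtoC (exp (- u)) * Rcpow u (s - RtoC 1)
   * G d c1 c2 t1 t2 k1 k2 (scaled_arg k1 u x) (scaled_arg k2 u y))%C.

(* Main.v *)
Require Import Defs.
From Stdlib Require Import Reals List ZArith Lra Lia.
From Coquelicot Require Import Coquelicot.
Open Scope R_scope.

(** Euler's integral gives [int_0^oo exp (- u) u ^ (a - 1) u ^ N du = (a)_N Gamma a],
    so the factor [(a)_(m+n)] of the general term of the Appell series is an
    integral, and what is left of the term is the general term of the Kampe de
    Feriet series at [(- k1) ^ k1 u x], [(- k2) ^ k2 u y]: this last point is
    Gauss's multiplication formula for shifted factorials
    ([poch_split_params], [G_term_F4_1_term]). The theorem is thus an exchange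
    of a double series with an improper integral, followed by a division by
    [Gamma a].

    The exchange ([is_Int0_Series2]) is dominated convergence, in a form that
    stays within Riemann integrals: on a compact subinterval the series
    converges uniformly and is integrated term by term, and the endpoints then
    tend to 0 and infinity by Tannery's theorem
    ([filterlim_Series_dominated]). The integrals of the absolute values
    are [Gamma (Re a) (Re a)_(m+n)] times coefficients; since
    [Re a + j <= |a + j|] when [0 < Re a], they are at most [Gamma (Re a)] times
    the absolute values of the terms of the Appell series, which is absolutely
    summable ([poch_Cmod_ge]). In the same way [u ^ N = O((a)_N)] makes the
    Kampe de Feriet series absolutely summable for every [u].

    The division needs [Gamma a <> 0] ([Gamma_Euler_neq_0]). By the functional
    equation a zero at [a] would be a zero at every [a + n]. But for large [n] the
    density [exp (- u) u ^ (Re a + n - 1)] concentrates around [Re a + n] so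
    sharply that the oscillation of [u ^ (i Im a)] cannot cancel the integral. *)

(** * Improper integrals over the positive half-line *)

Definition is_Int0 (f : R -> R) (l : R) : Prop :=
  is_RInt_gen f (at_right 0) (Rbar_locally p_infty) l.

Notation ends := (filter_prod (at_right 0) (Rbar_locally p_infty)).

Lemma ends_intro (P : R * R -> Prop) (d K : R) :
  0 < d -> (forall e M, 0 < e < d -> K < M -> P (e, M)) -> ends P.
Proof.
  intros Hd HP.
  apply Filter_prod with (Q := fun e => 0 < e < d) (R := fun M => K < M).
  - exists (mkposreal d Hd). intros z Hz Hz0. split; [exact Hz0|].
    unfold ball in Hz; simpl in Hz; unfold AbsRing_ball, abs, minus, plus, opp in Hz;
    simpl in Hz. rewrite Rabs_pos_eq in Hz; lra.
  - exists K. auto.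
  - auto.
Qed.

Lemma ends_far (e0 M0 : R) :
  0 < e0 -> ends (fun p => 0 < fst p /\ fst p < e0 /\ M0 < snd p /\ fst p < snd p).
Proof.
  intros He0. apply ends_intro with e0 (Rmax M0 e0); [exact He0|].
  intros e M He HM. simpl.
  assert (H1 := Rmax_l M0 e0). assert (H2 := Rmax_r M0 e0). lra.
Qed.

Lemma is_Int0_ex_RInt f l e M : is_Int0 f l -> 0 < e < M -> ex_RInt f e M.
Proof.
  intros Hf HeM.
  assert (H : ends (fun p => exists y, is_RInt f (fst p) (snd p) y /\ True)).
  { apply (Hf (fun _ => True)). exists (mkposreal 1 Rlt_0_1); auto. }
  destruct (filter_ex _ (filter_and _ _ H (ends_far e M (proj1 HeM))))
    as [[e' M'] [[y [Hy _]] Hfar]]. simpl in *.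
  apply (ex_RInt_Chasles_1 (V := R_CompleteNormedModule)) with M'; [lra|].
  apply (ex_RInt_Chasles_2 (V := R_CompleteNormedModule)) with e'; [lra|]. now exists y.
Qed.

(** The existence of the limit controls the proper integrals only for endpoints
    near 0 and infinity; those over smaller intervals follow by restriction. This
    turns the relational limit of [is_RInt_gen] into the limit of a function. *)
Lemma is_Int0_iff f l :
  is_Int0 f l <->
  (forall e M, 0 < e < M -> ex_RInt f e M) /\
  filterlim (fun p => RInt f (fst p) (snd p)) ends (locally l).
Proof.
  split.
  - intros Hf. split; [intros e M; now apply is_Int0_ex_RInt with l|].
    intros P HP. specialize (Hf P HP). unfold filtermapi in Hf. unfold filtermap.
    revert Hf. apply filter_imp. intros p [y [Hy Py]].
    now rewrite (is_RInt_unique _ _ _ _ Hy).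
  - intros [Hex Hl] P HP. specialize (Hl P HP). unfold filtermap in Hl. unfold filtermapi.
    generalize (filter_and _ _ Hl (ends_far 1 1 Rlt_0_1)).
    apply filter_imp. intros [e M]; simpl. intros [HP' HeM].
    exists (RInt f e M). split; [|exact HP'].
    apply (RInt_correct (V := R_CompleteNormedModule)). apply Hex. lra.
Qed.

Lemma is_Int0_ext f g l :
  (forall u, 0 < u -> f u = g u) -> is_Int0 f l -> is_Int0 g l.
Proof.
  intros Hfg. apply is_RInt_gen_ext.
  generalize (ends_far 1 1 Rlt_0_1). apply filter_imp. intros [e M]; simpl.
  intros HeM u. rewrite Rmin_left by lra. intros Hu. apply Hfg. lra.
Qed.

Lemma is_Int0_unique f l l' : is_Int0 f l -> is_Int0 f l' -> l = l'.
Proof.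
  intros H H'. apply is_Int0_iff in H, H'.
  apply (filterlim_locally_unique _ _ _ (proj2 H) (proj2 H')).
Qed.

Lemma is_Int0_plus f g lf lg :
  is_Int0 f lf -> is_Int0 g lg -> is_Int0 (fun u => f u + g u) (lf + lg).
Proof.
  intros Hf Hg. exact (is_RInt_gen_plus (V := R_NormedModule) f g lf lg Hf Hg).
Qed.

Lemma is_Int0_scal c f l : is_Int0 f l -> is_Int0 (fun u => c * f u) (c * l).
Proof.
  intros Hf. exact (is_RInt_gen_scal (V := R_NormedModule) f c l Hf).
Qed.

Lemma RInt_mono_interval g e M e' M' :
  (forall u, 0 < u -> 0 <= g u) -> (forall e M, 0 < e < M -> ex_RInt g e M) ->
  0 < e' -> e' < e -> e < M -> M < M' -> RInt g e M <= RInt g e' M'.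
Proof.
  intros Hpos Hex H1 H2 H3 H4.
  rewrite <- (RInt_Chasles g e' e M') by (apply Hex; lra).
  rewrite <- (RInt_Chasles g e M M') by (apply Hex; lra).
  unfold plus; simpl.
  assert (A : 0 <= RInt g e' e).
  { apply RInt_ge_0; [lra|apply Hex; lra|]. intros; apply Hpos; lra. }
  assert (B : 0 <= RInt g M M').
  { apply RInt_ge_0; [lra|apply Hex; lra|]. intros; apply Hpos; lra. }
  lra.
Qed.

Lemma RInt_le_Int0 g l e M :
  (forall u, 0 < u -> 0 <= g u) -> is_Int0 g l -> 0 < e < M -> RInt g e M <= l.
Proof.
  intros Hpos Hg HeM. apply is_Int0_iff in Hg. destruct Hg as [Hex Hl].
  apply Rnot_lt_le. intros Hlt.
  assert (Heps : 0 < RInt g e M - l) by lra.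
  assert (H := proj1 (filterlim_locally _ _) Hl (mkposreal _ Heps)).
  destruct (filter_ex _ (filter_and _ _ H (ends_far e M (proj1 HeM))))
    as [[e' M'] [Hb Hfar]]. simpl in *.
  assert (Hmono : RInt g e M <= RInt g e' M') by (apply RInt_mono_interval; auto; lra).
  unfold ball in Hb; simpl in Hb; unfold AbsRing_ball, abs, minus, plus, opp in Hb;
    simpl in Hb.
  apply Rabs_lt_between in Hb. lra.
Qed.

Lemma is_Int0_le f g lf lg :
  (forall u, 0 < u -> f u <= g u) -> is_Int0 f lf -> is_Int0 g lg -> lf <= lg.
Proof.
  intros Hle Hf Hg.
  assert (Hd := is_Int0_plus _ _ _ _ Hg (is_Int0_scal (-1) _ _ Hf)).
  assert (H0 : 0 <= lg + -1 * lf); [|lra].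
  apply Rle_trans with (RInt (fun u => g u + -1 * f u) 1 2).
  - apply RInt_ge_0; [lra|apply is_Int0_ex_RInt with (1 := Hd); lra|].
    intros u Hu. specialize (Hle u). lra.
  - apply RInt_le_Int0; [|exact Hd|lra].
    intros u Hu. specialize (Hle u). lra.
Qed.

(** The integrals of a nonnegative function increase with the interval, so they
    converge to their supremum. *)
Lemma is_Int0_nonneg_bounded h B :
  (forall u, 0 < u -> 0 <= h u) ->
  (forall e M, 0 < e < M -> ex_RInt h e M) ->
  (forall e M, 0 < e < M -> RInt h e M <= B) ->
  exists l, is_Int0 h l.
Proof.
  intros Hpos Hex HB.
  destruct (completeness (fun r => exists e M, 0 < e < M /\ r = RInt h e M))
    as [l [Hub Hlub]].
  - exists B. intros r [e [M [HeM ->]]]. auto.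
  - exists (RInt h 1 2), 1, 2. split; [lra|reflexivity].
  - exists l. apply is_Int0_iff. split; [exact Hex|].
    apply filterlim_locally. intros eps.
    destruct (Classical_Prop.classic
      (exists e M, 0 < e < M /\ l - eps < RInt h e M)) as [[e [M [HeM Hl]]]|Hno].
    + generalize (ends_far e M (proj1 HeM)). apply filter_imp.
      intros [e' M'] Hfar. simpl in *.
      assert (H1 : RInt h e M <= RInt h e' M') by (apply RInt_mono_interval; auto; lra).
      assert (H2 : RInt h e' M' <= l) by (apply Hub; exists e', M'; split; [lra|auto]).
      unfold ball; simpl; unfold AbsRing_ball, abs, minus, plus, opp; simpl.
      assert (He := cond_pos eps).
      apply Rabs_lt_between. lra.
    + exfalso. assert (Hle : l <= l - eps).
      { apply Hlub. intros r [e [M [HeM ->]]]. apply Rnot_lt_le. intros Hlt.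
        apply Hno. now exists e, M. }
      assert (He := cond_pos eps). lra.
Qed.

(** [f + g] is nonnegative and bounded by [2 g]; subtract [g] again. *)
Lemma is_Int0_dominated f g lg :
  (forall u, 0 < u -> Rabs (f u) <= g u) ->
  (forall e M, 0 < e < M -> ex_RInt f e M) ->
  is_Int0 g lg -> exists l, is_Int0 f l.
Proof.
  intros Hdom Hex Hg.
  assert (Hg0 := proj1 (proj1 (is_Int0_iff _ _) Hg)).
  destruct (is_Int0_nonneg_bounded (fun u => f u + g u) (2 * lg)) as [l Hl].
  - intros u Hu. specialize (Hdom u Hu). apply Rabs_le_between in Hdom. lra.
  - intros e M HeM. apply (ex_RInt_plus (V := R_NormedModule)); auto.
  - intros e M HeM. apply Rle_trans with (RInt (fun u => 2 * g u) e M).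
    + apply RInt_le; [lra| | |].
      * apply (ex_RInt_plus (V := R_NormedModule)); auto.
      * apply (ex_RInt_scal (V := R_NormedModule)); auto.
      * intros u Hu. specialize (Hdom u ltac:(lra)).
        apply Rabs_le_between in Hdom. lra.
    + apply RInt_le_Int0; [|now apply is_Int0_scal|exact HeM].
      intros u Hu. specialize (Hdom u Hu). assert (H := Rabs_pos (f u)). lra.
  - exists (l + -1 * lg).
    apply is_Int0_ext with (fun u => (f u + g u) + -1 * g u); [intros; ring|].
    apply is_Int0_plus; [exact Hl|now apply is_Int0_scal].
Qed.

(** The antiderivative [A] is given together with its limits at both ends. *)
Lemma is_Int0_derive (A f : R -> R) (l0 l1 : R) :
  (forall u, 0 < u -> is_derive A u (f u)) ->
  (forall u, 0 < u -> continuous f u) ->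
  filterlim A (at_right 0) (locally l0) ->
  filterlim A (Rbar_locally p_infty) (locally l1) ->
  is_Int0 f (l1 - l0).
Proof.
  intros HA Hf H0 H1. apply is_Int0_iff.
  assert (HI : forall e M, 0 < e < M -> is_RInt f e M (A M - A e)).
  { intros e M HeM. apply (is_RInt_derive (V := R_CompleteNormedModule));
      intros u; rewrite Rmin_left, Rmax_right by lra; intros Hu;
      [apply HA|apply Hf]; lra. }
  split; [intros e M HeM; eexists; now apply HI|].
  apply filterlim_ext_loc with (fun p => A (snd p) - A (fst p)).
  - generalize (ends_far 1 1 Rlt_0_1). apply filter_imp. intros [e M]; simpl.
    intros HeM. symmetry. apply is_RInt_unique, HI. lra.
  - apply (filterlim_comp_2 (G := locally l1) (H := locally (- l0)) (fun p => A (snd p)) (fun p => - A (fst p)) Rplus).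
    + apply filterlim_comp with (2 := H1). apply filterlim_snd.
    + apply filterlim_comp with (locally l0); [|apply (filterlim_opp (K := R_AbsRing) (V := R_NormedModule))].
      apply filterlim_comp with (2 := H0). apply filterlim_fst.
    + apply (filterlim_plus (K := R_AbsRing) (V := R_NormedModule)).
Qed.

(** * Integration of series term by term *)

Lemma ex_series_dominated (a b : nat -> R) :
  (forall n, Rabs (a n) <= b n) -> ex_series b -> ex_series a.
Proof. apply (ex_series_le (K := R_AbsRing) (V := R_CompleteNormedModule)). Qed.

Lemma Rabs_Series_le (a b : nat -> R) :
  (forall n, Rabs (a n) <= b n) -> ex_series b -> Rabs (Series a) <= Series b.
Proof.
  intros Hab Hb.
  apply Rle_trans with (Series (fun n => Rabs (a n))).
  - apply Series_Rabs. apply ex_series_dominated with b; [|exact Hb].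
    intros n. now rewrite Rabs_Rabsolu.
  - apply Series_le; [|exact Hb]. intros n; split; [apply Rabs_pos|apply Hab].
Qed.

Lemma Series_tail_small (b : nat -> R) (eps : posreal) :
  ex_series b -> exists N, (0 < N)%nat /\ Rabs (Series (fun k => b (N + k)%nat)) < eps.
Proof.
  intros Hb.
  assert (Hs := Series_correct _ Hb).
  destruct (proj1 (filterlim_locally _ _) Hs eps) as [N HN].
  exists (S N). split; [lia|].
  specialize (HN N (le_n N)).
  rewrite (Series_incr_n b (S N)) in HN by (auto; lia).
  rewrite sum_n_Reals in HN. simpl pred in HN.
  unfold ball in HN; simpl in HN; unfold AbsRing_ball, abs, minus, plus, opp in HN;
    simpl in HN.
  rewrite <- Rabs_Ropp.
  match type of HN with Rabs ?x < _ => 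
    replace (- _) with x by (simpl; ring) end.
  exact HN.
Qed.

Lemma filterlim_sum_f_R0 {T} (F : (T -> Prop) -> Prop) {FF : Filter F}
    (a : nat -> T -> R) (l : nat -> R) N :
  (forall n, filterlim (a n) F (locally (l n))) ->
  filterlim (fun t => sum_f_R0 (fun n => a n t) N) F (locally (sum_f_R0 l N)).
Proof.
  intros Ha. induction N as [|N IH]; simpl; [apply Ha|].
  apply (filterlim_comp_2 _ _ Rplus IH (Ha (S N))).
  apply (filterlim_plus (K := R_AbsRing) (V := R_NormedModule)).
Qed.

(** Tannery's theorem: dominated convergence for series. Past a rank where the
    tail of [J] is small, the tails of all the series are small as well, and
    the remaining finite sum converges term by term. *)
Lemma filterlim_Series_dominated {T} (F : (T -> Prop) -> Prop) {FF : ProperFilter F}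
    (a : nat -> T -> R) (l J : nat -> R) :
  F (fun t => forall n, Rabs (a n t) <= J n) ->
  (forall n, Rabs (l n) <= J n) ->
  (forall n, filterlim (a n) F (locally (l n))) ->
  ex_series J ->
  filterlim (fun t => Series (fun n => a n t)) F (locally (Series l)).
Proof.
  intros Hdom Hl Ha HJ. apply filterlim_locally. intros eps.
  assert (He := cond_pos eps).
  assert (He3 : 0 < eps / 3) by lra.
  destruct (Series_tail_small J (mkposreal _ He3) HJ) as [N [HN Htail]].
  simpl in Htail.
  assert (HJN : ex_series (fun k => J (N + k)%nat)) by now apply ex_series_incr_n.
  assert (Hfin := filterlim_sum_f_R0 F a l (pred N) Ha).
  assert (Hfin' := proj1 (filterlim_locally _ _) Hfin (mkposreal _ He3)).
  generalize (filter_and _ _ Hdom Hfin'). apply filter_imp.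
  intros t [Hd Hf].
  unfold ball in *; simpl in *; unfold AbsRing_ball, abs, minus, plus, opp in *;
    simpl in *.
  rewrite (Series_incr_n (fun n => a n t) N HN)
    by (apply ex_series_dominated with J; auto).
  rewrite (Series_incr_n l N HN) by (apply ex_series_dominated with J; auto).
  assert (H1 := Rabs_Series_le _ _ (fun k => Hd (N + k)%nat) HJN).
  assert (H2 := Rabs_Series_le _ _ (fun k => Hl (N + k)%nat) HJN).
  simpl in H1, H2.
  apply Rabs_lt_between in Htail, Hf. apply Rabs_le_between in H1, H2.
  apply Rabs_lt_between. lra.
Qed.

Lemma is_RInt_sum_n (f : nat -> R -> R) a b N :
  (forall n, ex_RInt (f n) a b) ->
  is_RInt (fun u => sum_n (fun n => f n u) N) a b (sum_n (fun n => RInt (f n) a b) N).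
Proof.
  intros Hf. induction N as [|N IH].
  - rewrite sum_O. apply is_RInt_ext with (f 0%nat).
    + intros u _. now rewrite sum_O.
    + apply (RInt_correct (V := R_CompleteNormedModule)), Hf.
  - rewrite sum_Sn.
    apply is_RInt_ext with (fun u => plus (sum_n (fun n => f n u) N) (f (S N) u)).
    + intros u _. now rewrite sum_Sn.
    + apply (is_RInt_plus (V := R_NormedModule)); [exact IH|].
      apply (RInt_correct (V := R_CompleteNormedModule)), Hf.
Qed.

(** The uniform limit theorem for integrals needs uniform convergence on the
    whole line, so the functions are first cut off outside of [a, b]. *)
Lemma is_RInt_Series (f : nat -> R -> R) (B : nat -> R) a b :
  a <= b ->
  (forall n, ex_RInt (f n) a b) ->
  (forall n u, a <= u <= b -> Rabs (f n u) <= B n) ->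
  ex_series B ->
  is_RInt (fun u => Series (fun n => f n u)) a b (Series (fun n => RInt (f n) a b)).
Proof.
  intros Hab Hf HB HsB.
  set (cut := fun u => if Rle_dec a u then if Rle_dec u b then 1 else 0 else 0).
  assert (Hin : forall u, a <= u <= b -> cut u = 1).
  { intros u Hu. unfold cut. destruct (Rle_dec a u); [|lra]. destruct (Rle_dec u b); lra. }
  assert (HB0 : forall n, 0 <= B n).
  { intros n. apply Rle_trans with (2 := HB n a ltac:(lra)). apply Rabs_pos. }
  assert (HcutB : forall n u, Rabs (cut u * f n u) <= B n).
  { intros n u. unfold cut. destruct (Rle_dec a u); [destruct (Rle_dec u b)|].
    - rewrite Rmult_1_l. apply HB. lra.
    - rewrite Rmult_0_l, Rabs_R0. apply HB0.
    - rewrite Rmult_0_l, Rabs_R0. apply HB0. }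
  destruct (filterlim_RInt (V := R_CompleteNormedModule)
      (fun N u => sum_n (fun n => cut u * f n u) N) a b eventually _
      (fun u => Series (fun n => cut u * f n u))
      (fun N => sum_n (fun n => RInt (f n) a b) N)) as [I [HI1 HI2]].
  - intros N. apply is_RInt_ext with (fun u => sum_n (fun n => f n u) N).
    + rewrite Rmin_left, Rmax_right by lra. intros u Hu. apply sum_n_ext.
      intros n. rewrite Hin by lra. symmetry. apply Rmult_1_l.
    + now apply is_RInt_sum_n.
  - apply (filterlim_locally (U := fct_UniformSpace R R_UniformSpace)).
    intros eps.
    assert (Hs := Series_correct _ HsB).
    destruct (proj1 (filterlim_locally _ _) Hs eps) as [N0 HN0].
    exists N0. intros N HN u.
    specialize (HN0 N HN).
    rewrite (Series_incr_n B (S N)) in HN0 by (auto; lia).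
    rewrite (Series_incr_n (fun n => cut u * f n u) (S N)); [|lia|].
    2: { apply ex_series_dominated with B; auto. }
    rewrite sum_n_Reals in *. simpl pred in *.
    assert (H1 := Rabs_Series_le (fun k => cut u * f (S N + k)%nat u) _
      (fun k => HcutB (S N + k)%nat u) (proj1 (ex_series_incr_n B (S N)) HsB)).
    unfold ball in *; simpl in *; unfold AbsRing_ball, abs, minus, plus, opp in *;
      simpl in *.
    apply Rabs_lt_between in HN0. apply Rabs_le_between in H1.
    apply Rabs_lt_between. lra.
  - assert (HS : is_series (fun n => RInt (f n) a b) I) by exact HI1.
    rewrite (is_series_unique _ _ HS).
    apply is_RInt_ext with (2 := HI2). rewrite Rmin_left, Rmax_right by lra.
    intros u Hu. apply Series_ext. intros n. rewrite Hin by lra. apply Rmult_1_l.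
Qed.

(** Dominated convergence for a series of improper integrals. On a compact
    subinterval the series is integrated term by term; the resulting integrals
    [RInt (f n) e M] are bounded by [J n] uniformly in the endpoints, so that
    the passage to the limit in the endpoints is Tannery's theorem. *)
Lemma is_Int0_Series (f g : nat -> R -> R) (I J : nat -> R) :
  (forall n u, 0 < u -> Rabs (f n u) <= g n u) ->
  (forall n, is_Int0 (f n) (I n)) ->
  (forall n, is_Int0 (g n) (J n)) ->
  ex_series J ->
  (forall e M, 0 < e < M -> exists B : nat -> R, ex_series B /\
     forall n u, e <= u <= M -> g n u <= B n) ->
  is_Int0 (fun u => Series (fun n => f n u)) (Series I) /\
  (forall n, Rabs (I n) <= J n).
Proof.
  intros Hfg Hf Hg HJ Hloc.
  assert (Hg0 : forall n u, 0 < u -> 0 <= g n u).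
  { intros n u Hu. apply Rle_trans with (2 := Hfg n u Hu). apply Rabs_pos. }
  assert (HIJ : forall n, Rabs (I n) <= J n).
  { intros n. apply Rabs_le_between. split.
    - assert (H : -1 * J n <= I n); [|lra].
      apply is_Int0_le with (2 := is_Int0_scal (-1) _ _ (Hg n)) (3 := Hf n).
      intros u Hu. specialize (Hfg n u Hu). apply Rabs_le_between in Hfg. lra.
    - apply is_Int0_le with (2 := Hf n) (3 := Hg n).
      intros u Hu. specialize (Hfg n u Hu). apply Rabs_le_between in Hfg. lra. }
  split; [|exact HIJ].
  assert (Hexf : forall n e M, 0 < e < M -> ex_RInt (f n) e M).
  { intros n e M. apply is_Int0_ex_RInt with (1 := Hf n). }
  assert (Hexg : forall n e M, 0 < e < M -> ex_RInt (g n) e M).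
  { intros n e M. apply is_Int0_ex_RInt with (1 := Hg n). }
  assert (Hcompact : forall e M, 0 < e < M ->
    is_RInt (fun u => Series (fun n => f n u)) e M (Series (fun n => RInt (f n) e M))).
  { intros e M HeM. destruct (Hloc e M HeM) as [B [HB HgB]].
    apply is_RInt_Series with B; auto; [lra|].
    intros n u Hu. apply Rle_trans with (g n u); [apply Hfg; lra|auto]. }
  apply is_Int0_iff. split; [intros e M HeM; eexists; now apply Hcompact|].
  apply filterlim_ext_loc
    with (fun p => Series (fun n => RInt (f n) (fst p) (snd p))).
  - generalize (ends_far 1 1 Rlt_0_1). apply filter_imp. intros [e M]; simpl.
    intros HeM. symmetry. apply is_RInt_unique, Hcompact. lra.
  - apply (filterlim_Series_dominated ends (fun n p => RInt (f n) (fst p) (snd p)) I J);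
      auto.
    + generalize (ends_far 1 1 Rlt_0_1). apply filter_imp. intros [e M]; simpl.
      intros HeM n. apply Rle_trans with (RInt (g n) e M).
      * apply (norm_RInt_le (V := R_NormedModule) (f n) (g n) e M); [lra| | |].
        -- intros u Hu. apply Hfg. lra.
        -- apply (RInt_correct (V := R_CompleteNormedModule)), Hexf. lra.
        -- apply (RInt_correct (V := R_CompleteNormedModule)), Hexg. lra.
      * apply RInt_le_Int0; auto. lra.
    + intros n. apply (proj1 (is_Int0_iff _ _) (Hf n)).
Qed.

(** Two nested uses of the simple series: the rows are summed first, and the row
    sums of [g] dominate those of [f]. *)
Lemma is_Int0_Series2 (f g : nat -> nat -> R -> R) (I J : nat -> nat -> R) :
  (forall m n u, 0 < u -> Rabs (f m n u) <= g m n u) ->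
  (forall m n, is_Int0 (f m n) (I m n)) ->
  (forall m n, is_Int0 (g m n) (J m n)) ->
  (forall m, ex_series (J m)) ->
  ex_series (fun m => Series (J m)) ->
  (forall e M, 0 < e < M -> exists B : nat -> nat -> R,
     (forall m, ex_series (B m)) /\ ex_series (fun m => Series (B m)) /\
     forall m n u, e <= u <= M -> g m n u <= B m n) ->
  is_Int0 (fun u => Series (fun m => Series (fun n => f m n u)))
          (Series (fun m => Series (I m))).
Proof.
  intros Hfg Hf Hg HJ HJ2 Hloc.
  assert (Hg0 : forall m n u, 0 < u -> 0 <= g m n u).
  { intros m n u Hu. apply Rle_trans with (2 := Hfg m n u Hu). apply Rabs_pos. }
  assert (Hlocrow : forall m e M, 0 < e < M -> exists B : nat -> R, ex_series B /\
     forall n u, e <= u <= M -> g m n u <= B n).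
  { intros m e M HeM. destruct (Hloc e M HeM) as [B [HB [_ HgB]]]. exists (B m); auto. }
  assert (Hexg : forall m u, 0 < u -> ex_series (fun n => g m n u)).
  { intros m u Hu. destruct (Hlocrow m u (u + 1) ltac:(lra)) as [B [HB HgB]].
    apply ex_series_dominated with B; [|exact HB].
    intros n. rewrite Rabs_pos_eq by auto. apply HgB. lra. }
  apply (is_Int0_Series (fun m u => Series (fun n => f m n u))
           (fun m u => Series (fun n => g m n u)) (fun m => Series (I m))
           (fun m => Series (J m))).
  - intros m u Hu. apply Rabs_Series_le; auto.
  - intros m. apply (is_Int0_Series (f m) (g m) (I m) (J m)); auto.
  - intros m. apply (is_Int0_Series (g m) (g m) (J m) (J m)); auto.
    intros n u Hu. rewrite Rabs_pos_eq by auto. apply Rle_refl.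
  - exact HJ2.
  - intros e M HeM. destruct (Hloc e M HeM) as [B [HB [HB2 HgB]]].
    exists (fun m => Series (B m)). split; [exact HB2|].
    intros m u Hu. apply Series_le; [|apply HB].
    intros n. split; [apply Hg0; lra|auto].
Qed.

Lemma is_CInt0_pair (f : R -> C) (l : C) :
  is_Int0 (fun u => Re (f u)) (Re l) -> is_Int0 (fun u => Im (f u)) (Im l) ->
  ex_CInt0 f /\ CInt0 f = l.
Proof.
  intros HRe HIm.
  assert (H : is_RInt_gen (V := C_R_NormedModule) f (at_right 0) (Rbar_locally p_infty) l).
  { apply is_Int0_iff in HRe, HIm. destruct HRe as [Hex1 Hl1], HIm as [Hex2 Hl2].
    intros P [eps HP].
    assert (H1 := proj1 (filterlim_locally _ _) Hl1 eps).
    assert (H2 := proj1 (filterlim_locally _ _) Hl2 eps).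
    generalize (filter_and _ _ (filter_and _ _ H1 H2) (ends_far 1 1 Rlt_0_1)).
    unfold filtermapi. apply filter_imp. intros [e M]; simpl. intros [[B1 B2] HeM].
    exists (RInt (fun u => Re (f u)) e M, RInt (fun u => Im (f u)) e M). split.
    - apply (is_RInt_fct_extend_pair (U := R_NormedModule) (V := R_NormedModule));
        apply (RInt_correct (V := R_CompleteNormedModule)); [apply Hex1|apply Hex2]; lra.
    - apply HP. split; [exact B1|exact B2]. }
  split; [now exists l|].
  exact (is_RInt_gen_unique (V := C_R_CompleteNormedModule) _ _ H).
Qed.

(** * Euler's integral in the right half-plane *)

Definition Euler_integrand (z : C) (u : R) : C :=
  (RtoC (exp (- u)) * Rcpow u (z - RtoC 1))%C.

(** For real [s] this is [exp (- u) u ^ (s - 1)], the modulus of the integrand at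
    any [z] of real part [s]; [gamma_cos] and [gamma_sin] are the real and
    imaginary parts of the integrand at [z = s + i q]. *)
Definition gamma_kernel (s u : R) : R := exp (- u) * exp ((s - 1) * ln u).
Definition gamma_cos (s q u : R) : R := gamma_kernel s u * cos (q * ln u).
Definition gamma_sin (s q u : R) : R := gamma_kernel s u * sin (q * ln u).

Lemma gamma_kernel_pos s u : 0 < gamma_kernel s u.
Proof. apply Rmult_lt_0_compat; apply exp_pos. Qed.

Lemma gamma_kernel_shift s u : 0 < u -> gamma_kernel (s + 1) u = u * gamma_kernel s u.
Proof.
  intros Hu. unfold gamma_kernel.
  replace ((s + 1 - 1) * ln u) with (ln u + (s - 1) * ln u) by ring.
  rewrite exp_plus, exp_ln by exact Hu. ring.
Qed.

Lemma gamma_kernel_add s N u : 0 < u ->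
  gamma_kernel (s + INR N) u = gamma_kernel s u * u ^ N.
Proof.
  intros Hu. induction N as [|N IH]; [simpl; rewrite Rplus_0_r; ring|].
  rewrite S_INR, <- Rplus_assoc, gamma_kernel_shift, IH by exact Hu. simpl. ring.
Qed.

Lemma gamma_cos_bound s q u : Rabs (gamma_cos s q u) <= gamma_kernel s u.
Proof.
  unfold gamma_cos. assert (H := gamma_kernel_pos s u).
  rewrite Rabs_mult, (Rabs_pos_eq (gamma_kernel s u)) by lra.
  rewrite <- (Rmult_1_r (gamma_kernel s u)) at 2.
  apply Rmult_le_compat_l; [lra|]. apply Rabs_le, COS_bound.
Qed.

Lemma gamma_sin_bound s q u : Rabs (gamma_sin s q u) <= gamma_kernel s u.
Proof.
  unfold gamma_sin. assert (H := gamma_kernel_pos s u).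
  rewrite Rabs_mult, (Rabs_pos_eq (gamma_kernel s u)) by lra.
  rewrite <- (Rmult_1_r (gamma_kernel s u)) at 2.
  apply Rmult_le_compat_l; [lra|]. apply Rabs_le, SIN_bound.
Qed.

Lemma Euler_integrand_components z u :
  Euler_integrand z u = (gamma_cos (Re z) (Im z) u, gamma_sin (Re z) (Im z) u).
Proof.
  unfold Euler_integrand, gamma_cos, gamma_sin, gamma_kernel, Rcpow, Re, Im, Cmult.
  simpl. replace (fst z + - (1)) with (fst z - 1) by ring.
  replace (snd z + - 0) with (snd z) by ring. f_equal; ring.
Qed.

Lemma Euler_integrand_Cmod z u : Cmod (Euler_integrand z u) = gamma_kernel (Re z) u.
Proof.
  rewrite Euler_integrand_components. unfold gamma_cos, gamma_sin, Cmod. simpl.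
  set (k := gamma_kernel _ _). set (th := _ * ln u).
  transitivity (sqrt (k * k)); [|apply sqrt_square, Rlt_le, gamma_kernel_pos].
  f_equal. assert (H := sin2_cos2 th). unfold Rsqr in H.
  transitivity (k * k * (sin th * sin th + cos th * cos th)); [ring|].
  rewrite H. ring.
Qed.

Lemma is_derive_gamma_cos s q u : 0 < u ->
  is_derive (gamma_cos (s + 1) q) u
    (s * gamma_cos s q u + - q * gamma_sin s q u + -1 * gamma_cos (s + 1) q u).
Proof.
  intros Hu. unfold gamma_cos, gamma_sin. rewrite gamma_kernel_shift by exact Hu.
  assert (E : gamma_kernel s u = exp (- u) * exp ((s + 1 - 1) * ln u) / u).
  { change (exp (- u) * exp ((s + 1 - 1) * ln u)) with (gamma_kernel (s + 1) u).
    rewrite gamma_kernel_shift by exact Hu. field. lra. }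
  rewrite E. unfold gamma_kernel. auto_derive; [tauto|]. unfold Rdiv. field. lra.
Qed.

Lemma is_derive_gamma_sin s q u : 0 < u ->
  is_derive (gamma_sin (s + 1) q) u
    (s * gamma_sin s q u + q * gamma_cos s q u + -1 * gamma_sin (s + 1) q u).
Proof.
  intros Hu. unfold gamma_cos, gamma_sin. rewrite gamma_kernel_shift by exact Hu.
  assert (E : gamma_kernel s u = exp (- u) * exp ((s + 1 - 1) * ln u) / u).
  { change (exp (- u) * exp ((s + 1 - 1) * ln u)) with (gamma_kernel (s + 1) u).
    rewrite gamma_kernel_shift by exact Hu. field. lra. }
  rewrite E. unfold gamma_kernel. auto_derive; [tauto|]. unfold Rdiv. field. lra.
Qed.

Lemma gamma_cos_continuous s q u : 0 < u -> continuous (gamma_cos s q) u.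
Proof.
  intros Hu. apply (ex_derive_continuous (K := R_AbsRing) (V := R_NormedModule)).
  replace s with ((s - 1) + 1) by ring.
  eexists. now apply is_derive_gamma_cos.
Qed.

Lemma gamma_sin_continuous s q u : 0 < u -> continuous (gamma_sin s q) u.
Proof.
  intros Hu. apply (ex_derive_continuous (K := R_AbsRing) (V := R_NormedModule)).
  replace s with ((s - 1) + 1) by ring.
  eexists. now apply is_derive_gamma_sin.
Qed.

Lemma gamma_cos_0 s u : gamma_cos s 0 u = gamma_kernel s u.
Proof. unfold gamma_cos. rewrite Rmult_0_l, cos_0. ring. Qed.

Lemma exp_monotone u v : u <= v -> exp u <= exp v.
Proof. intros [H| ->]; [now apply Rlt_le, exp_increasing|apply Rle_refl]. Qed.

Lemma ln_le_sub_1 r : 0 < r -> ln r <= r - 1.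
Proof.
  intros Hr. assert (H := exp_ineq1_le (ln r)). rewrite exp_ln in H by exact Hr. lra.
Qed.

(** The tangent line of the logarithm at [p]. *)
Lemma ln_tangent p v : 0 < p -> 0 < v -> p * ln v <= p * ln p + v - p.
Proof.
  intros Hp Hv.
  assert (H := ln_le_sub_1 (v / p) ltac:(now apply Rdiv_lt_0_compat)).
  rewrite ln_div in H by assumption.
  apply (Rmult_le_compat_l p) in H; [|lra].
  replace (p * (v / p - 1)) with (v - p) in H by (field; lra). lra.
Qed.

Lemma gamma_kernel_compact_bound s e M : 0 < e < M ->
  exists W, forall u, e <= u <= M -> gamma_kernel s u <= W.
Proof.
  intros HeM. exists (exp (Rabs (s - 1) * (Rabs (ln e) + Rabs (ln M)))). intros u Hu.
  unfold gamma_kernel. rewrite <- exp_plus. apply exp_monotone.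
  assert (L1 : ln e <= ln u) by (apply ln_le; lra).
  assert (L2 : ln u <= ln M) by (apply ln_le; lra).
  assert (L : Rabs (ln u) <= Rabs (ln e) + Rabs (ln M)).
  { apply Rabs_le.
    assert (A1 := Rle_abs (ln M)). assert (A2 := Rle_abs (- ln e)).
    rewrite Rabs_Ropp in A2. assert (A3 := Rabs_pos (ln e)).
    assert (A4 := Rabs_pos (ln M)). lra. }
  assert (H3 : (s - 1) * ln u <= Rabs (s - 1) * (Rabs (ln e) + Rabs (ln M))).
  { apply Rle_trans with (1 := Rle_abs _). rewrite Rabs_mult.
    apply Rmult_le_compat_l; [apply Rabs_pos|exact L]. }
  lra.
Qed.

Lemma gamma_kernel_ex_RInt s e M : 0 < e < M -> ex_RInt (gamma_kernel s) e M.
Proof.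
  intros HeM. apply (ex_RInt_continuous (V := R_CompleteNormedModule)).
  rewrite Rmin_left, Rmax_right by lra. intros u Hu.
  apply continuous_ext with (gamma_cos s 0); [apply gamma_cos_0|].
  apply gamma_cos_continuous. lra.
Qed.

(** The kernel is bounded, up to a constant, by the derivative of
    [(u / (1 + u)) ^ s], a function with values in [0, 1]. *)
Lemma gamma_kernel_integrable s : 0 < s -> exists l, is_Int0 (gamma_kernel s) l.
Proof.
  intros Hs.
  set (A := fun u => exp (s * (ln u - ln (1 + u)))).
  set (dA := fun u => s * (/ u - / (1 + u)) * exp (s * (ln u - ln (1 + u)))).
  set (C0 := exp ((s + 1) * ln (s + 1)) / s).
  assert (HC0 : 0 < C0) by (apply Rdiv_lt_0_compat; [apply exp_pos|exact Hs]).
  assert (HA : forall u, 0 < u -> is_derive A u (dA u)).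
  { intros u Hu. unfold A, dA. auto_derive; [lra|]. unfold Rminus. field. lra. }
  assert (HdA : forall u, 0 < u -> continuous dA u).
  { intros u Hu. apply (ex_derive_continuous (K := R_AbsRing) (V := R_NormedModule)).
    unfold dA. auto_derive. lra. }
  assert (HA1 : forall u, 0 < u -> 0 < A u <= 1).
  { intros u Hu. unfold A. split; [apply exp_pos|].
    rewrite <- exp_0 at 2. apply exp_monotone.
    assert (Hln : ln u < ln (1 + u)) by (apply ln_increasing; lra).
    assert (H : 0 <= s * (ln (1 + u) - ln u)) by (apply Rmult_le_pos; lra). lra. }
  assert (Hle : forall u, 0 < u -> gamma_kernel s u <= C0 * dA u).
  { intros u Hu. unfold gamma_kernel, C0, dA.
    assert (Ht := ln_tangent (s + 1) (1 + u) ltac:(lra) ltac:(lra)).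
    assert (He : exp (- u) <= exp ((s + 1) * ln (s + 1) - (s + 1) * ln (1 + u)))
      by (apply exp_monotone; lra).
    apply Rle_trans with
      (exp ((s + 1) * ln (s + 1) - (s + 1) * ln (1 + u)) * exp ((s - 1) * ln u)).
    - apply Rmult_le_compat_r; [|exact He]. apply Rlt_le, exp_pos.
    - apply Req_le.
      replace (s * (/ u - / (1 + u))) with (s * (/ u * / (1 + u))) by (field; lra).
      replace (/ u) with (exp (- ln u)) by (rewrite exp_Ropp, exp_ln; auto).
      replace (/ (1 + u)) with (exp (- ln (1 + u))) by (rewrite exp_Ropp, exp_ln; lra).
      transitivity (exp ((s + 1) * ln (s + 1)) * (exp (- ln u) * exp (- ln (1 + u)))
                    * exp (s * (ln u - ln (1 + u)))); [|field; lra].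
      rewrite <- !exp_plus. f_equal. ring. }
  apply is_Int0_nonneg_bounded with C0.
  - intros u _. apply Rlt_le, gamma_kernel_pos.
  - apply gamma_kernel_ex_RInt.
  - intros e M HeM.
    assert (HI : is_RInt dA e M (A M - A e)).
    { apply (is_RInt_derive (V := R_CompleteNormedModule));
        intros u; rewrite Rmin_left, Rmax_right by lra; intros Hu;
        [apply HA|apply HdA]; lra. }
    assert (HI2 := is_RInt_scal (V := R_NormedModule) _ _ _ C0 _ HI).
    apply Rle_trans with (RInt (fun u => C0 * dA u) e M).
    + apply RInt_le; [lra|now apply gamma_kernel_ex_RInt|eexists; exact HI2|].
      intros u Hu. apply Hle. lra.
    + apply Rle_trans with (C0 * (A M - A e)); [apply Req_le, is_RInt_unique, HI2|].
      rewrite <- (Rmult_1_r C0) at 2. apply Rmult_le_compat_l; [lra|].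
      assert (H1 := HA1 M ltac:(lra)). assert (H2 := HA1 e ltac:(lra)). lra.
Qed.

Lemma Gamma_Euler_components z : 0 < Re z ->
  is_Int0 (gamma_cos (Re z) (Im z)) (Re (Gamma_Euler z)) /\
  is_Int0 (gamma_sin (Re z) (Im z)) (Im (Gamma_Euler z)).
Proof.
  intros Hz. destruct (gamma_kernel_integrable _ Hz) as [l Hl].
  destruct (is_Int0_dominated (gamma_cos (Re z) (Im z)) _ l
    (fun u _ => gamma_cos_bound _ _ u)) as [lc Hc]; [|exact Hl|].
  { intros e M HeM. apply (ex_RInt_continuous (V := R_CompleteNormedModule)).
    rewrite Rmin_left, Rmax_right by lra. intros u Hu.
    apply gamma_cos_continuous. lra. }
  destruct (is_Int0_dominated (gamma_sin (Re z) (Im z)) _ l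
    (fun u _ => gamma_sin_bound _ _ u)) as [ls Hs]; [|exact Hl|].
  { intros e M HeM. apply (ex_RInt_continuous (V := R_CompleteNormedModule)).
    rewrite Rmin_left, Rmax_right by lra. intros u Hu.
    apply gamma_sin_continuous. lra. }
  assert (HG : Gamma_Euler z = (lc, ls)).
  { apply is_CInt0_pair.
    - apply is_Int0_ext with (2 := Hc). intros u _.
      change (gamma_cos (Re z) (Im z) u = Re (Euler_integrand z u)).
      now rewrite Euler_integrand_components.
    - apply is_Int0_ext with (2 := Hs). intros u _.
      change (gamma_sin (Re z) (Im z) u = Im (Euler_integrand z u)).
      now rewrite Euler_integrand_components. }
  rewrite HG. now split.
Qed.

Lemma filterlim_squeeze_0 (F : (R -> Prop) -> Prop) {FF : Filter F} (f g : R -> R) :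
  F (fun u => Rabs (f u) <= g u) -> filterlim g F (locally 0) ->
  filterlim f F (locally 0).
Proof.
  intros Hfg Hg. apply filterlim_locally. intros eps.
  assert (H := proj1 (filterlim_locally _ _) Hg eps).
  generalize (filter_and _ _ Hfg H). apply filter_imp. intros u [H1 H2].
  unfold ball in *; simpl in *; unfold AbsRing_ball, abs, minus, plus, opp in *;
    simpl in *.
  rewrite Ropp_0, Rplus_0_r in *.
  apply Rle_lt_trans with (1 := H1). apply Rle_lt_trans with (2 := H2). apply Rle_abs.
Qed.

Lemma gamma_kernel_lim_0 s : 0 < s -> filterlim (gamma_kernel (s + 1)) (at_right 0) (locally 0).
Proof.
  intros Hs. apply (filterlim_squeeze_0 (at_right 0) _ (fun u => exp (s * ln u))).
  - exists (mkposreal 1 Rlt_0_1). intros u _ Hu.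
    rewrite Rabs_pos_eq by apply Rlt_le, gamma_kernel_pos. unfold gamma_kernel.
    replace (s + 1 - 1) with s by ring.
    rewrite <- (Rmult_1_l (exp (s * ln u))) at 2.
    apply Rmult_le_compat_r; [apply Rlt_le, exp_pos|].
    rewrite <- exp_0. apply exp_monotone. lra.
  - apply filterlim_comp with (Rbar_locally m_infty).
    + apply filterlim_comp with (Rbar_locally m_infty); [apply is_lim_ln_0|].
      assert (H := filterlim_Rbar_mult_l s m_infty).
      replace (Rbar_mult s m_infty) with m_infty in H; [exact H|].
      symmetry. now apply is_Rbar_mult_unique, is_Rbar_mult_sym, is_Rbar_mult_m_infty_pos.
    + apply is_lim_exp_m.
Qed.

Lemma gamma_kernel_lim_p s : 0 < s ->
  filterlim (gamma_kernel (s + 1)) (Rbar_locally p_infty) (locally 0).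
Proof.
  intros Hs.
  (* The tangent at 2 s spends only half of the exponential decay. *)
  apply (filterlim_squeeze_0 (Rbar_locally p_infty) _
    (fun u => exp (s * ln (2 * s)) * exp (- / 2 * u))).
  - exists 0. intros u Hu.
    rewrite Rabs_pos_eq by apply Rlt_le, gamma_kernel_pos. unfold gamma_kernel.
    rewrite <- !exp_plus. apply exp_monotone.
    assert (H := ln_tangent (2 * s) u ltac:(lra) Hu). lra.
  - replace 0 with (exp (s * ln (2 * s)) * 0) by ring.
    apply (filterlim_comp _ _ _ (fun u => exp (- / 2 * u)) (fun v => exp (s * ln (2 * s)) * v)
             _ (locally 0)).
    + apply filterlim_comp with (Rbar_locally m_infty); [|apply is_lim_exp_m].
      assert (H := filterlim_Rbar_mult_l (- / 2) p_infty).
      replace (Rbar_mult (- / 2) p_infty) with m_infty in H; [exact H|].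
      symmetry. apply is_Rbar_mult_unique, is_Rbar_mult_sym, is_Rbar_mult_p_infty_neg.
      simpl. lra.
    + apply (filterlim_scal_r (K := R_AbsRing) (V := R_NormedModule)).
Qed.

(** Integration by parts: the derivative of [exp (- u) * u ^ z] has integral 0
    over the half-line. *)
Lemma Gamma_Euler_succ z : 0 < Re z -> Gamma_Euler (z + 1)%C = (z * Gamma_Euler z)%C.
Proof.
  intros Hz.
  destruct (Gamma_Euler_components z Hz) as [Hc Hs].
  assert (ERe : Re (z + 1)%C = Re z + 1) by reflexivity.
  assert (EIm : Im (z + 1)%C = Im z) by (unfold Im; simpl; ring).
  destruct (Gamma_Euler_components (z + 1)%C) as [Hc' Hs']; [rewrite ERe; lra|].
  rewrite ERe, EIm in Hc', Hs'.
  assert (Hlim : forall F f, Filter F -> filterlim (gamma_kernel (Re z + 1)) F (locally 0) ->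
    (forall u, Rabs (f u) <= gamma_kernel (Re z + 1) u) -> filterlim f F (locally 0)).
  { intros F f FF Hk Hf. apply (filterlim_squeeze_0 F) with (2 := Hk).
    apply filter_forall. exact Hf. }
  assert (Dc := is_Int0_derive (gamma_cos (Re z + 1) (Im z)) _ 0 0
    (fun u Hu => is_derive_gamma_cos (Re z) (Im z) u Hu)).
  assert (Ds := is_Int0_derive (gamma_sin (Re z + 1) (Im z)) _ 0 0
    (fun u Hu => is_derive_gamma_sin (Re z) (Im z) u Hu)).
  assert (Ec := is_Int0_plus _ _ _ _ (is_Int0_plus _ _ _ _ (is_Int0_scal (Re z) _ _ Hc)
    (is_Int0_scal (- Im z) _ _ Hs)) (is_Int0_scal (-1) _ _ Hc')).
  assert (Es := is_Int0_plus _ _ _ _ (is_Int0_plus _ _ _ _ (is_Int0_scal (Re z) _ _ Hs)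
    (is_Int0_scal (Im z) _ _ Hc)) (is_Int0_scal (-1) _ _ Hs')).
  assert (Uc : 0 - 0 = Re z * Re (Gamma_Euler z) + - Im z * Im (Gamma_Euler z)
                       + -1 * Re (Gamma_Euler (z + 1)%C)).
  { apply is_Int0_unique with (2 := Ec). apply Dc.
    - intros u Hu.
      apply (continuous_plus (V := R_NormedModule));
        [apply (continuous_plus (V := R_NormedModule))|];
        apply (continuous_scal_r (V := R_NormedModule)).
      + now apply gamma_cos_continuous.
      + now apply gamma_sin_continuous.
      + now apply gamma_cos_continuous.
    - apply Hlim; [typeclasses eauto|now apply gamma_kernel_lim_0|].
      intros u; apply gamma_cos_bound.
    - apply Hlim; [typeclasses eauto|now apply gamma_kernel_lim_p|].
      intros u; apply gamma_cos_bound. }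
  assert (Us : 0 - 0 = Re z * Im (Gamma_Euler z) + Im z * Re (Gamma_Euler z)
                       + -1 * Im (Gamma_Euler (z + 1)%C)).
  { apply is_Int0_unique with (2 := Es). apply Ds.
    - intros u Hu.
      apply (continuous_plus (V := R_NormedModule));
        [apply (continuous_plus (V := R_NormedModule))|];
        apply (continuous_scal_r (V := R_NormedModule)).
      + now apply gamma_sin_continuous.
      + now apply gamma_cos_continuous.
      + now apply gamma_sin_continuous.
    - apply Hlim; [typeclasses eauto|now apply gamma_kernel_lim_0|].
      intros u; apply gamma_sin_bound.
    - apply Hlim; [typeclasses eauto|now apply gamma_kernel_lim_p|].
      intros u; apply gamma_sin_bound. }
  unfold Re, Im in *. destruct (Gamma_Euler z) as [g1 g2], (Gamma_Euler (z + 1)%C) as [h1 h2].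
  destruct z as [z1 z2]. simpl in *. unfold Cmult. simpl. f_equal; lra.
Qed.

Lemma Gamma_Euler_add z n : 0 < Re z ->
  Gamma_Euler (z + RtoC (INR n))%C = (poch z n * Gamma_Euler z)%C.
Proof.
  intros Hz. induction n as [|n IH].
  - simpl. rewrite Cplus_0_r. ring.
  - rewrite S_INR, RtoC_plus, Cplus_assoc, Gamma_Euler_succ.
    + rewrite IH. simpl poch. ring.
    + unfold Re in *. simpl. assert (H := pos_INR n). lra.
Qed.

(** * Nonvanishing of Euler's integral *)

Lemma cos_ge_quadratic t : 1 - t ^ 2 / 2 <= cos t.
Proof.
  assert (Hsin : forall v, 0 <= v -> Rabs (sin v) <= v).
  { intros v [Hv| <-]; [|rewrite sin_0, Rabs_R0; lra].
    apply Rabs_le. split; [|apply Rlt_le, sin_lt_x; exact Hv].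
    assert (Hb := SIN_bound v). destruct (Rle_lt_dec v 1) as [H1|H1]; [|lra].
    assert (Hp : 0 < sin v) by (apply sin_gt_0; [|assert (H := PI2_1)]; lra). lra. }
  assert (H2 : sin (t / 2) ^ 2 <= (t / 2) ^ 2).
  { rewrite <- (pow2_abs (sin _)), <- (pow2_abs (t / 2)).
    apply pow_incr. split; [apply Rabs_pos|].
    destruct (Rle_lt_dec 0 (t / 2)) as [H|H].
    - rewrite (Rabs_pos_eq (t / 2)) by lra. now apply Hsin.
    - rewrite <- (Rabs_Ropp (sin _)), <- sin_neg, <- (Rabs_Ropp (t / 2)).
      rewrite (Rabs_pos_eq (- (t / 2))) by lra. apply Hsin. lra. }
  replace t with (2 * (t / 2)) at 2 by field.
  rewrite cos_2a_sin. lra.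
Qed.

(** With [r = exp (2 v)] this is [|v| <= |exp v - exp (- v)|]. *)
Lemma sqr_ln_le r : 0 < r -> ln r ^ 2 <= 4 * (r - 2 + / r).
Proof.
  intros Hr. set (v := ln r / 2).
  assert (Er : r = exp v * exp v).
  { rewrite <- exp_plus. replace (v + v) with (ln r) by (unfold v; field).
    now rewrite exp_ln. }
  assert (E1 : exp v * exp (- v) = 1).
  { rewrite <- exp_plus, Rplus_opp_r. apply exp_0. }
  assert (Ei : / r = exp (- v) * exp (- v)).
  { rewrite Er, exp_Ropp. field. apply Rgt_not_eq, exp_pos. }
  replace (ln r ^ 2) with (4 * v ^ 2) by (unfold v; field).
  apply Rmult_le_compat_l; [lra|].
  replace (r - 2 + / r) with ((exp v - exp (- v)) ^ 2) by (rewrite Ei, Er; nra).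
  assert (H1 := exp_ineq1_le v). assert (H2 := exp_ineq1_le (- v)).
  assert (H3 := exp_pos v). assert (H4 := exp_pos (- v)).
  destruct (Rle_lt_dec 0 v) as [Hv|Hv].
  - assert (exp (- v) <= 1) by (rewrite <- exp_0; apply exp_monotone; lra).
    apply pow_incr. lra.
  - assert (exp v <= 1) by (rewrite <- exp_0; apply exp_monotone; lra).
    replace (v ^ 2) with ((- v) ^ 2) by ring.
    replace ((exp v - exp (- v)) ^ 2) with ((exp (- v) - exp v) ^ 2) by ring.
    apply pow_incr. lra.
Qed.

Lemma Gamma_Euler_real_pos s : 0 < s ->
  is_Int0 (gamma_kernel s) (Re (Gamma_Euler (RtoC s))) /\ 0 < Re (Gamma_Euler (RtoC s)).
Proof.
  intros Hs. destruct (Gamma_Euler_components (RtoC s) Hs) as [H _].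
  unfold Re at 1, Im in H. simpl in H.
  assert (Hk : is_Int0 (gamma_kernel s) (Re (Gamma_Euler (RtoC s)))).
  { apply is_Int0_ext with (2 := H). intros u _. apply gamma_cos_0. }
  split; [exact Hk|].
  apply Rlt_le_trans with (RInt (gamma_kernel s) 1 2).
  - apply RInt_gt_0; [lra|intros u _; apply gamma_kernel_pos|].
    intros u Hu. apply continuous_ext with (gamma_cos s 0); [apply gamma_cos_0|].
    apply gamma_cos_continuous. lra.
  - apply RInt_le_Int0; [intros u _; apply Rlt_le, gamma_kernel_pos|exact Hk|lra].
Qed.

Lemma Gamma_Euler_real_succ s : 0 < s ->
  Re (Gamma_Euler (RtoC (s + 1))) = s * Re (Gamma_Euler (RtoC s)).
Proof.
  intros Hs. rewrite RtoC_plus, Gamma_Euler_succ by exact Hs.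
  unfold Re; simpl. ring.
Qed.

(** For [s] large the density [gamma_kernel s] concentrates near [u = s], where
    the oscillating factor [u ^ (i q)] is close to the constant [s ^ (i q)]:
    after division by this constant, the real part of the factor is at least
    [1 - 2 q ^ 2 (u / s - 2 + s / u)], and the mean of the latter is
    [1 - 2 q ^ 2 / (s - 1)]. *)
Lemma Gamma_Euler_neq_0_far z : 1 + 2 * Im z ^ 2 < Re z -> Gamma_Euler z <> RtoC 0.
Proof.
  intros Hfar H0. set (s := Re z) in *. set (q := Im z) in *.
  assert (Hq : 0 <= q ^ 2) by apply pow2_ge_0.
  destruct (Gamma_Euler_components z ltac:(fold s; lra)) as [Hc Hs].
  fold s q in Hc, Hs. rewrite H0 in Hc, Hs. unfold Re, Im in Hc, Hs; simpl in Hc, Hs.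
  destruct (Gamma_Euler_real_pos (s - 1) ltac:(lra)) as [K0 Kpos].
  destruct (Gamma_Euler_real_pos s ltac:(lra)) as [K1 _].
  destruct (Gamma_Euler_real_pos (s + 1) ltac:(lra)) as [K2 _].
  rewrite (Gamma_Euler_real_succ s) in K2 by lra.
  replace (RtoC s) with (RtoC (s - 1 + 1)) in K1, K2 by (f_equal; ring).
  rewrite Gamma_Euler_real_succ in K1, K2 by lra.
  set (g := Re (Gamma_Euler (RtoC (s - 1)))) in *.
  assert (Hrot := is_Int0_plus _ _ _ _ (is_Int0_scal (cos (q * ln s)) _ _ Hc)
                                       (is_Int0_scal (sin (q * ln s)) _ _ Hs)).
  assert (Hlow := is_Int0_plus _ _ _ _ (is_Int0_plus _ _ _ _
    (is_Int0_scal (1 + 4 * q ^ 2) _ _ K1) (is_Int0_scal (- (2 * q ^ 2 / s)) _ _ K2))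
    (is_Int0_scal (- (2 * q ^ 2 * s)) _ _ K0)).
  assert (Hle := fun H => is_Int0_le _ _ _ _ H Hlow Hrot).
  assert (E : (1 + 4 * q ^ 2) * ((s - 1) * g) + - (2 * q ^ 2 / s) * (s * ((s - 1) * g))
              + - (2 * q ^ 2 * s) * g = g * (s - 1 - 2 * q ^ 2)) by (field; lra).
  rewrite E in Hle.
  assert (Hpos : 0 < g * (s - 1 - 2 * q ^ 2)) by (apply Rmult_lt_0_compat; lra).
  enough (Hpt : forall u, 0 < u ->
    (1 + 4 * q ^ 2) * gamma_kernel s u + - (2 * q ^ 2 / s) * gamma_kernel (s + 1) u
    + - (2 * q ^ 2 * s) * gamma_kernel (s - 1) u <=
    cos (q * ln s) * gamma_cos s q u + sin (q * ln s) * gamma_sin s q u)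
    by (specialize (Hle Hpt); lra).
  clear - Hfar Hq. intros u Hu.
  rewrite (gamma_kernel_shift s u Hu).
  assert (Ek : gamma_kernel s u = u * gamma_kernel (s - 1) u).
  { rewrite <- gamma_kernel_shift by exact Hu. f_equal. ring. }
  assert (Ek' : gamma_kernel (s - 1) u = gamma_kernel s u / u) by (rewrite Ek; field; lra).
  rewrite Ek'. unfold gamma_cos, gamma_sin. assert (Hk := gamma_kernel_pos s u).
  set (k := gamma_kernel s u) in *.
  replace (cos (q * ln s) * (k * cos (q * ln u)) + sin (q * ln s) * (k * sin (q * ln u)))
    with (k * cos (q * ln u - q * ln s)) by (rewrite cos_minus; ring).
  assert (Hr : 0 < u / s) by (apply Rdiv_lt_0_compat; lra).
  assert (H1 := sqr_ln_le (u / s) Hr).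
  assert (H2 := cos_ge_quadratic (q * ln (u / s))).
  rewrite ln_div in H1, H2 by lra.
  replace (q * (ln u - ln s)) with (q * ln u - q * ln s) in H2 by ring.
  replace ((q * ln u - q * ln s) ^ 2) with (q ^ 2 * (ln u - ln s) ^ 2) in H2 by ring.
  assert (H3 := Rmult_le_compat_l _ _ _ Hq H1).
  replace (/ (u / s)) with (s / u) in H3 by (field; lra).
  assert (E : (1 + 4 * q ^ 2) * k + - (2 * q ^ 2 / s) * (u * k) + - (2 * q ^ 2 * s) * (k / u)
              = k * (1 - 2 * (q ^ 2 * (u / s - 2 + s / u)))) by (field; lra).
  rewrite E. apply Rmult_le_compat_l; lra.
Qed.

(** The recurrence moves a zero at [z] to a zero at [z + n], for every [n]. *)
Lemma Gamma_Euler_neq_0 z : 0 < Re z -> Gamma_Euler z <> RtoC 0.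
Proof.
  intros Hz H0.
  destruct (INR_unbounded (1 + 2 * Im z ^ 2)) as [n Hn].
  apply (Gamma_Euler_neq_0_far (z + RtoC (INR n))%C).
  - unfold Re, Im in *; simpl in *. rewrite Rplus_0_r. lra.
  - rewrite Gamma_Euler_add, H0 by exact Hz. ring.
Qed.

(** In the right half-plane the continuation takes no step: [N = 0]. *)
Lemma Gamma_right_half_plane z : 0 < Re z -> Gamma z = Gamma_Euler z.
Proof.
  intros Hz. unfold Gamma.
  assert (Hup : (up (- Re z) <= 0)%Z).
  { destruct (archimed (- Re z)) as [_ H].
    apply Z.lt_succ_r. apply lt_IZR. simpl. lra. }
  replace (Z.to_nat (up (- Re z))) with 0%nat by lia.
  simpl. rewrite Cplus_0_r. field.
Qed.

(** * Shifted factorials *)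

Lemma poch_neq_0 c : (forall n : nat, Re c <> - INR n) -> forall l, poch c l <> RtoC 0.
Proof.
  intros Hc l. induction l as [|l IH]; simpl; [apply C1_nz|].
  apply Cmult_neq_0; [exact IH|]. intros H. apply (Hc l).
  apply (f_equal Re) in H. unfold Re in *. simpl in *. lra.
Qed.

Lemma poch_add c l k :
  poch c (l + k) = (poch c l * poch (c + RtoC (INR l)) k)%C.
Proof.
  induction k as [|k IH].
  - rewrite Nat.add_0_r. simpl. ring.
  - rewrite Nat.add_succ_r. simpl poch. rewrite IH, plus_INR, RtoC_plus. ring.
Qed.

Lemma poch_list_cons p ps l : poch_list (p :: ps) l = (poch p l * poch_list ps l)%C.
Proof. reflexivity. Qed.

Lemma poch_list_succ ps l :
  poch_list ps (S l) =
  (poch_list ps l * fold_right Cmult (RtoC 1) (map (fun p => p + RtoC (INR l)) ps))%C.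
Proof.
  induction ps as [|p ps IH].
  - unfold poch_list. simpl. ring.
  - rewrite !poch_list_cons, IH. simpl. ring.
Qed.

Lemma Copp_pow k l : ((- RtoC (INR k)) ^ l = RtoC (-1) ^ l * RtoC (INR k) ^ l)%C.
Proof. rewrite <- Cpow_mult_l. f_equal. rewrite <- RtoC_mult, <- RtoC_opp. f_equal. ring. Qed.

(** The step from [m] to [m + 1] in the multiplication formula, stated for a
    block of [n] consecutive parameters so that it can be proved by induction;
    it is used with [j0 = 0] and [n = k]. *)
Lemma prod_split_params t k m j0 n : (1 <= k)%nat ->
  (RtoC (INR k) ^ n * fold_right Cmult (RtoC 1)
     (map (fun p => p + RtoC (INR m))
        (map (fun j => ((- t + RtoC (INR j)) / RtoC (INR k))) (seq j0 n))))%C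
  = poch (- t + RtoC (INR (m * k)) + RtoC (INR j0))%C n.
Proof.
  intros Hk. revert j0. induction n as [|n IH]; intros j0; [simpl; ring|].
  assert (Hk0 : RtoC (INR k) <> RtoC 0).
  { intros H. apply RtoC_inj in H. assert (H1 := lt_0_INR k ltac:(lia)). lra. }
  simpl seq. cbn [map fold_right]. rewrite Cpow_S.
  transitivity ((RtoC (INR k) * ((- t + RtoC (INR j0)) / RtoC (INR k) + RtoC (INR m)))
    * (RtoC (INR k) ^ n * fold_right Cmult (RtoC 1)
     (map (fun p => p + RtoC (INR m))
        (map (fun j => ((- t + RtoC (INR j)) / RtoC (INR k))) (seq (S j0) n)))))%C; [ring|].
  rewrite IH. change (S n) with (1 + n)%nat. rewrite poch_add.
  rewrite (S_INR j0), mult_INR, RtoC_plus, RtoC_mult. simpl poch. simpl INR.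
  rewrite !Cplus_assoc, Cplus_0_r, Cmult_1_l. f_equal. field. exact Hk0.
Qed.

(** Gauss's multiplication formula for shifted factorials,
    [k ^ (m k) prod_j ((- t + j) / k)_m = (- t)_(m k)]. *)
Lemma poch_split_params t k m : (1 <= k)%nat ->
  (poch_list (split_params t k) m * ((- RtoC (INR k)) ^ k) ^ m)%C
  = (RtoC (-1) ^ (m * k) * poch (- t) (m * k))%C.
Proof.
  intros Hk.
  assert (H : (poch_list (split_params t k) m * (RtoC (INR k) ^ k) ^ m)%C
              = poch (- t)%C (m * k)).
  { induction m as [|m IH].
    - simpl. unfold poch_list.
      assert (Hmap : forall ps : list C,
        fold_right Cmult (RtoC 1) (map (fun p => poch p 0) ps) = RtoC 1).
      { induction ps as [|p ps IHps]; [reflexivity|].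
        cbn [map fold_right]. rewrite IHps. simpl. ring. }
      rewrite Hmap. ring.
    - rewrite poch_list_succ, Cpow_S.
      replace (S m * k)%nat with (m * k + k)%nat by lia.
      rewrite poch_add, <- IH.
      assert (Hp := prod_split_params t k m 0 k Hk).
      simpl (INR 0) in Hp. rewrite Cplus_0_r in Hp. rewrite <- Hp.
      unfold split_params. ring. }
  rewrite <- H, Copp_pow, Cpow_mult_l, Nat.mul_comm, Cpow_mult_r. ring.
Qed.

(** Factor by factor, [Re a + j <= |a + j|]. *)
Lemma poch_Cmod_ge a l : 0 < Re a ->
  Re (poch (RtoC (Re a)) l) <= Cmod (poch a l) /\ 0 < Re (poch (RtoC (Re a)) l) /\
  Im (poch (RtoC (Re a)) l) = 0.
Proof.
  intros Ha. induction l as [|l [IH1 [IH2 IH3]]].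
  - simpl. rewrite Cmod_1. unfold Re, Im; simpl. lra.
  - simpl poch. set (P := poch (RtoC (Re a)) l) in *. set (Q := poch a l) in *.
    rewrite Cmod_mult.
    assert (Hl := pos_INR l).
    assert (Hle : Re a + INR l <= Cmod (a + RtoC (INR l))%C).
    { apply Rle_trans with (2 := re_le_Cmod _). unfold Re in *; simpl. apply Rle_abs. }
    assert (E : Re (P * (RtoC (Re a) + RtoC (INR l)))%C = Re P * (Re a + INR l)).
    { unfold Re, Im in *. simpl. rewrite IH3. ring. }
    rewrite E. split; [|split].
    + apply Rmult_le_compat; lra.
    + apply Rmult_lt_0_compat; lra.
    + unfold Re, Im in *. simpl. rewrite IH3. ring.
Qed.

(** From a rank [N0 > u] on, each new factor [|a + N|] exceeds [u], so the
    finitely many ratios before that rank determine the constant. *)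
Lemma pow_le_poch a u : 0 < Re a -> 0 <= u ->
  exists K, 0 < K /\ forall N, u ^ N <= K * Cmod (poch a N).
Proof.
  intros Ha Hu.
  assert (Hpos : forall N, 0 < Cmod (poch a N)).
  { intros N. destruct (poch_Cmod_ge a N Ha) as [H1 [H2 _]]. lra. }
  destruct (INR_unbounded u) as [N0 HN0].
  assert (Hfin : forall n, exists K, 0 < K /\
            forall N, (N <= n)%nat -> u ^ N <= K * Cmod (poch a N)).
  { induction n as [|n [K [HK HKN]]].
    - exists 1. split; [lra|]. intros N HN. replace N with 0%nat by lia.
      simpl. rewrite Cmod_1. lra.
    - assert (H0 : 0 <= u ^ S n / Cmod (poch a (S n))).
      { apply Rle_mult_inv_pos; [apply pow_le; exact Hu|apply Hpos]. }
      exists (K + u ^ S n / Cmod (poch a (S n))). split; [lra|]. intros N HN.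
      destruct (Nat.eq_dec N (S n)) as [->|Hne].
      + rewrite Rmult_plus_distr_r.
        replace (u ^ S n / Cmod (poch a (S n)) * Cmod (poch a (S n))) with (u ^ S n)
          by (field; apply Rgt_not_eq, Hpos).
        assert (H1 := Rmult_lt_0_compat _ _ HK (Hpos (S n))). lra.
      + apply Rle_trans with (1 := HKN N ltac:(lia)).
        apply Rmult_le_compat_r; [apply Rlt_le, Hpos|lra]. }
  destruct (Hfin N0) as [K [HK HKN]]. exists K. split; [exact HK|].
  intros N. induction N as [|N IH]; [apply HKN; lia|].
  destruct (Nat.le_gt_cases (S N) N0) as [Hle|Hgt]; [now apply HKN|].
  simpl poch. rewrite Cmod_mult. simpl pow.
  assert (HN : INR N0 <= INR N) by (apply le_INR; lia).
  assert (Hle : u <= Cmod (a + RtoC (INR N))%C).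
  { apply Rle_trans with (2 := re_le_Cmod _). unfold Re in *; simpl.
    apply Rle_trans with (2 := Rle_abs _). lra. }
  replace (K * (Cmod (poch a N) * Cmod (a + RtoC (INR N)%R)))
    with (Cmod (a + RtoC (INR N))%C * (K * Cmod (poch a N))) by ring.
  apply Rmult_le_compat; auto. now apply pow_le.
Qed.

(** * Complex double series *)

Lemma abs_summable2_components (f : nat -> nat -> C) (P : C -> R) :
  (forall z, Rabs (P z) <= Cmod z) -> abs_summable2 f ->
  (forall m, ex_series (fun n => P (f m n))) /\
  ex_series (fun m => Series (fun n => P (f m n))).
Proof.
  intros HP [H1 H2]. split.
  - intros m. apply ex_series_dominated with (fun n => Cmod (f m n)); auto.
  - apply ex_series_dominated with (2 := H2). intros m. apply Rabs_Series_le; auto.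
Qed.

Lemma Re_bound z : Rabs (Re z) <= Cmod z.
Proof. apply re_le_Cmod. Qed.

Lemma Im_bound z : Rabs (Im z) <= Cmod z.
Proof. apply Rle_trans with (2 := Rmax_Cmod z), Rmax_r. Qed.

Lemma abs_summable2_le (f g : nat -> nat -> C) K :
  (forall m n, Cmod (f m n) <= K * Cmod (g m n)) -> abs_summable2 g -> abs_summable2 f.
Proof.
  intros Hfg [H1 H2].
  assert (H1' : forall m, ex_series (fun n => K * Cmod (g m n))).
  { intros m. apply (ex_series_scal_l (K := R_AbsRing) (V := R_NormedModule) K), H1. }
  split.
  - intros m. apply ex_series_dominated with (2 := H1' m). intros n.
    rewrite Rabs_pos_eq by apply Cmod_ge_0. apply Hfg.
  - apply ex_series_dominated with (fun m => K * Series (fun n => Cmod (g m n))).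
    + intros m. rewrite <- Series_scal_l. apply Rabs_Series_le; [|apply H1'].
      intros n. rewrite Rabs_pos_eq by apply Cmod_ge_0. apply Hfg.
    + apply (ex_series_scal_l (K := R_AbsRing) (V := R_NormedModule) K), H2.
Qed.

Lemma Series2_lin (a b : nat -> nat -> R) p q :
  (forall m, ex_series (a m)) -> ex_series (fun m => Series (a m)) ->
  (forall m, ex_series (b m)) -> ex_series (fun m => Series (b m)) ->
  Series (fun m => Series (fun n => p * a m n + q * b m n)) =
  p * Series (fun m => Series (a m)) + q * Series (fun m => Series (b m)).
Proof.
  intros Ha Ha2 Hb Hb2.
  assert (Hs : forall c (s : nat -> R), ex_series s -> ex_series (fun n => c * s n)).
  { intros c s. apply (ex_series_scal_l (K := R_AbsRing) (V := R_NormedModule)). }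
  rewrite <- !Series_scal_l, <- Series_plus by auto.
  apply Series_ext. intros m. rewrite Series_plus, !Series_scal_l by auto. reflexivity.
Qed.

Lemma Csum2_scal c (f : nat -> nat -> C) :
  abs_summable2 f -> Csum2 (fun m n => c * f m n)%C = (c * Csum2 f)%C.
Proof.
  intros Hf.
  destruct (abs_summable2_components f Re Re_bound Hf) as [R1 R2].
  destruct (abs_summable2_components f Im Im_bound Hf) as [I1 I2].
  assert (LRe := Series2_lin _ _ (Re c) (- Im c) R1 R2 I1 I2).
  assert (LIm := Series2_lin _ _ (Im c) (Re c) R1 R2 I1 I2).
  unfold Csum2, Cseries, Cmult. simpl. f_equal.
  - etransitivity; [|etransitivity; [exact LRe|unfold Re, Im; ring]].
    apply Series_ext; intros m. apply Series_ext; intros n. unfold Re, Im; simpl; ring.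
  - etransitivity; [|etransitivity; [exact LIm|unfold Re, Im; ring]].
    apply Series_ext; intros m. apply Series_ext; intros n. unfold Re, Im; simpl; ring.
Qed.

Lemma Csum2_ext (f g : nat -> nat -> C) :
  (forall m n, f m n = g m n) -> Csum2 f = Csum2 g.
Proof.
  intros H. unfold Csum2, Cseries; simpl.
  f_equal; apply Series_ext; intros m; apply Series_ext; intros n; now rewrite H.
Qed.

(** * The integral representation *)

Lemma INR_fact_neq_0 n : RtoC (INR (fact n)) <> RtoC 0.
Proof. intros H. apply RtoC_inj in H. now apply (INR_fact_neq_0 n). Qed.

(** By the multiplication formula the arguments [(- k) ^ k u z] turn the terms of
    the two series into each other, up to the factor [(a)_(m+n)] that the
    integration has to produce from [u ^ (m+n)]. *)
Lemma G_term_F4_1_term k1 k2 a b c1 c2 t1 t2 x y u m n :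
  (1 <= k1)%nat -> (1 <= k2)%nat ->
  (forall n : nat, Re c1 <> - INR n) -> (forall n : nat, Re c2 <> - INR n) ->
  0 < Re a ->
  G_term b c1 c2 t1 t2 k1 k2 (scaled_arg k1 u x) (scaled_arg k2 u y) m n
  = (F4_1_term a b c1 c2 t1 t2 k1 k2 x y m n / poch a (m + n) * RtoC (u ^ (m + n)))%C.
Proof.
  intros Hk1 Hk2 Hc1 Hc2 Ha.
  unfold G_term, KdF_term, F4_1_term.
  rewrite <- (poch_split_params t1 k1 m Hk1), <- (poch_split_params t2 k2 n Hk2).
  unfold scaled_arg. rewrite !Cpow_mult_l, RtoC_pow, Cpow_add_r.
  unfold poch_list at 1 4 5 6. simpl map. simpl fold_right.
  assert (Na : poch a (m + n) <> RtoC 0).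
  { apply poch_neq_0. intros j Hj. assert (Hj' := pos_INR j). lra. }
  assert (N1 := poch_neq_0 c1 Hc1 m). assert (N2 := poch_neq_0 c2 Hc2 n).
  assert (F1 := INR_fact_neq_0 m). assert (F2 := INR_fact_neq_0 n).
  field. auto 10 using C1_nz.
Qed.

(** Each term is integrated by [Gamma (a + N) = (a)_N Gamma a], which restores the
    factor divided out in [T]; the exchange of sum and integral is carried out on
    the real and imaginary parts. *)
Lemma F4_1_representation k1 k2 a b c1 c2 t1 t2 x y :
  (1 <= k1)%nat -> (1 <= k2)%nat ->
  (forall n : nat, Re c1 <> - INR n) -> (forall n : nat, Re c2 <> - INR n) ->
  abs_summable2 (F4_1_term a b c1 c2 t1 t2 k1 k2 x y) ->
  0 < Re a ->
  (forall u : R, 0 < u ->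
     abs_summable2 (G_term b c1 c2 t1 t2 k1 k2
                      (scaled_arg k1 u x) (scaled_arg k2 u y))) /\
  ex_CInt0 (G_integrand a b c1 c2 t1 t2 k1 k2 x y) /\
  F4_1 a b c1 c2 t1 t2 k1 k2 x y
  = (RtoC 1 / Gamma a * CInt0 (G_integrand a b c1 c2 t1 t2 k1 k2 x y))%C.
Proof.
  intros Hk1 Hk2 Hc1 Hc2 HF Ha.
  set (F := F4_1_term a b c1 c2 t1 t2 k1 k2 x y) in *.
  set (T := fun m n => (F m n / poch a (m + n))%C).
  set (Gt := fun u => G_term b c1 c2 t1 t2 k1 k2 (scaled_arg k1 u x) (scaled_arg k2 u y)).
  assert (HGt : forall u m n, Gt u m n = (T m n * RtoC (u ^ (m + n)))%C).
  { intros u m n. now apply G_term_F4_1_term. }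
  assert (Hpa : forall N, poch a N <> RtoC 0).
  { intros N. apply poch_neq_0. intros j Hj. assert (Hj' := pos_INR j). lra. }
  assert (HT : forall m n, Cmod (T m n) * Cmod (poch a (m + n)) = Cmod (F m n)).
  { intros m n. rewrite <- Cmod_mult. f_equal. unfold T. field. apply Hpa. }
  assert (HGmod : forall u m n, 0 < u -> Cmod (Gt u m n) = Cmod (T m n) * u ^ (m + n)).
  { intros u m n Hu. rewrite HGt, Cmod_mult, Cmod_R, Rabs_pos_eq; [reflexivity|].
    apply pow_le. lra. }
  assert (HGsum : forall u, 0 < u -> abs_summable2 (Gt u)).
  { intros u Hu. destruct (pow_le_poch a u Ha ltac:(lra)) as [K [HK HuK]].
    apply abs_summable2_le with F K; [|exact HF]. intros m n.
    rewrite HGmod, <- HT by exact Hu.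
    replace (K * (Cmod (T m n) * Cmod (poch a (m + n))))
      with (Cmod (T m n) * (K * Cmod (poch a (m + n)))) by ring.
    apply Rmult_le_compat_l; [apply Cmod_ge_0|apply HuK]. }
  split; [exact HGsum|].
  set (f := fun u m n => (Euler_integrand a u * Gt u m n)%C).
  assert (HI : forall u, 0 < u -> G_integrand a b c1 c2 t1 t2 k1 k2 x y u = Csum2 (f u)).
  { intros u Hu. unfold f. rewrite Csum2_scal by auto. reflexivity. }
  set (s := Re a).
  (* The modulus of [f u m n]; its integral [J m n] is at most a constant times
     the modulus of [F m n]. *)
  set (g := fun m n u => Cmod (T m n) * gamma_kernel (s + INR (m + n)) u).
  assert (Hterm : forall m n,
    is_Int0 (fun u => Re (f u m n)) (Re (Gamma_Euler a * F m n)%C) /\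
    is_Int0 (fun u => Im (f u m n)) (Im (Gamma_Euler a * F m n)%C)).
  { intros m n.
    assert (E : (Gamma_Euler a * F m n)%C = (T m n * Gamma_Euler (a + RtoC (INR (m + n))))%C).
    { rewrite Gamma_Euler_add by exact Ha. unfold T. field. apply Hpa. }
    rewrite E.
    destruct (Gamma_Euler_components (a + RtoC (INR (m + n)))%C) as [Hc Hs].
    { unfold Re in *. simpl. assert (H := pos_INR (m + n)). lra. }
    replace (Re (a + RtoC (INR (m + n)))%C) with (s + INR (m + n)) in Hc, Hs by reflexivity.
    replace (Im (a + RtoC (INR (m + n)))%C) with (Im a) in Hc, Hs
      by (unfold Im; simpl; ring).
    set (w := Gamma_Euler (a + RtoC (INR (m + n)))%C) in *.
    split.
    - replace (Re (T m n * w)%C) with (Re (T m n) * Re w + - Im (T m n) * Im w)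
        by (unfold Re, Im; simpl; ring).
      apply is_Int0_ext with (2 := is_Int0_plus _ _ _ _
        (is_Int0_scal (Re (T m n)) _ _ Hc) (is_Int0_scal (- Im (T m n)) _ _ Hs)).
      intros u Hu. unfold f. rewrite HGt, Euler_integrand_components. fold s. unfold gamma_cos, gamma_sin.
      rewrite gamma_kernel_add by exact Hu. unfold Re, Im; simpl. ring.
    - replace (Im (T m n * w)%C) with (Re (T m n) * Im w + Im (T m n) * Re w)
        by (unfold Re, Im; simpl; ring).
      apply is_Int0_ext with (2 := is_Int0_plus _ _ _ _
        (is_Int0_scal (Re (T m n)) _ _ Hs) (is_Int0_scal (Im (T m n)) _ _ Hc)).
      intros u Hu. unfold f. rewrite HGt, Euler_integrand_components. fold s. unfold gamma_cos, gamma_sin.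
      rewrite gamma_kernel_add by exact Hu. unfold Re, Im; simpl. ring. }
  assert (Hdom : forall m n u, 0 < u -> Cmod (f u m n) <= g m n u).
  { intros m n u Hu. unfold f, g.
    rewrite Cmod_mult, Euler_integrand_Cmod, HGmod, gamma_kernel_add by exact Hu.
    apply Req_le. fold s. ring. }
  set (gam := Re (Gamma_Euler (RtoC s))).
  set (J := fun m n => Cmod (T m n) * (Re (poch (RtoC s) (m + n)) * gam)).
  assert (Hgam : 0 < gam) by (now apply Gamma_Euler_real_pos).
  assert (HgJ : forall m n, is_Int0 (g m n) (J m n)).
  { intros m n. apply is_Int0_scal.
    assert (Hpos := pos_INR (m + n)).
    destruct (Gamma_Euler_real_pos (s + INR (m + n)) ltac:(unfold s; lra)) as [H _].
    rewrite RtoC_plus, Gamma_Euler_add in H by exact Ha.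
    replace (Re (poch (RtoC s) (m + n)) * gam)
      with (Re (poch (RtoC s) (m + n) * Gamma_Euler (RtoC s))%C); [exact H|].
    destruct (poch_Cmod_ge a (m + n) Ha) as [_ [_ Him]].
    fold s in Him. unfold gam, Re, Im in *. simpl. rewrite Him. ring. }
  assert (HJF : forall m n, Rabs (J m n) <= gam * Cmod (F m n)).
  { intros m n. destruct (poch_Cmod_ge a (m + n) Ha) as [H1 [H2 _]]. fold s in H1, H2.
    assert (H3 := Cmod_ge_0 (T m n)).
    unfold J. rewrite Rabs_pos_eq.
    - rewrite <- HT.
      replace (Cmod (T m n) * (Re (poch (RtoC s) (m + n)) * gam))
        with (gam * (Cmod (T m n) * Re (poch (RtoC s) (m + n)))) by ring.
      apply Rmult_le_compat_l; [lra|]. now apply Rmult_le_compat_l.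
    - apply Rmult_le_pos; [exact H3|]. apply Rmult_le_pos; lra. }
  assert (HFs : (forall m, ex_series (fun n => gam * Cmod (F m n))) /\
                ex_series (fun m => Series (fun n => gam * Cmod (F m n)))).
  { destruct HF as [HF1 HF2]. split.
    - intros m. apply (ex_series_scal_l (K := R_AbsRing) (V := R_NormedModule)), HF1.
    - apply ex_series_ext with (fun m => gam * Series (fun n => Cmod (F m n))).
      + intros m. now rewrite Series_scal_l.
      + apply (ex_series_scal_l (K := R_AbsRing) (V := R_NormedModule)), HF2. }
  assert (HJ1 : forall m, ex_series (J m)).
  { intros m. apply ex_series_dominated with (2 := proj1 HFs m). auto. }
  assert (HJ2 : ex_series (fun m => Series (J m))).
  { apply ex_series_dominated with (2 := proj2 HFs).
    intros m. apply Rabs_Series_le; [auto|apply HFs]. }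
  assert (Hloc : forall e M, 0 < e < M -> exists B : nat -> nat -> R,
     (forall m, ex_series (B m)) /\ ex_series (fun m => Series (B m)) /\
     forall m n u, e <= u <= M -> g m n u <= B m n).
  { intros e M HeM.
    destruct (gamma_kernel_compact_bound s e M HeM) as [W HW].
    (* The powers of [u] are largest at [M], where the Kampe de Feriet series
       converges absolutely. *)
    exists (fun m n => W * Cmod (Gt M m n)).
    destruct (HGsum M ltac:(lra)) as [S1 S2]. split; [|split].
    - intros m. apply (ex_series_scal_l (K := R_AbsRing) (V := R_NormedModule)), S1.
    - apply ex_series_ext with (fun m => W * Series (fun n => Cmod (Gt M m n))).
      + intros m. now rewrite Series_scal_l.
      + apply (ex_series_scal_l (K := R_AbsRing) (V := R_NormedModule)), S2.
    - intros m n u Hu. unfold g. rewrite gamma_kernel_add, HGmod by lra.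
      replace (Cmod (T m n) * (gamma_kernel s u * u ^ (m + n)))
        with (gamma_kernel s u * (Cmod (T m n) * u ^ (m + n))) by ring.
      assert (H1 := Cmod_ge_0 (T m n)).
      apply Rmult_le_compat; [apply Rlt_le, gamma_kernel_pos| |now apply HW|].
      + apply Rmult_le_pos; [exact H1|apply pow_le; lra].
      + apply Rmult_le_compat_l; [exact H1|]. apply pow_incr. lra. }
  assert (HRe := is_Int0_Series2 (fun m n u => Re (f u m n)) g _ J
    (fun m n u Hu => Rle_trans _ _ _ (Re_bound _) (Hdom m n u Hu))
    (fun m n => proj1 (Hterm m n)) HgJ HJ1 HJ2 Hloc).
  assert (HIm := is_Int0_Series2 (fun m n u => Im (f u m n)) g _ J
    (fun m n u Hu => Rle_trans _ _ _ (Im_bound _) (Hdom m n u Hu))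
    (fun m n => proj2 (Hterm m n)) HgJ HJ1 HJ2 Hloc).
  destruct (is_CInt0_pair (G_integrand a b c1 c2 t1 t2 k1 k2 x y)
    (Csum2 (fun m n => Gamma_Euler a * F m n)%C)) as [Hex HInt].
  - apply is_Int0_ext with (2 := HRe). intros u Hu. now rewrite HI.
  - apply is_Int0_ext with (2 := HIm). intros u Hu. now rewrite HI.
  - split; [exact Hex|].
    rewrite HInt, Csum2_scal, Gamma_right_half_plane by assumption.
    unfold F4_1. fold F. field. now apply Gamma_Euler_neq_0.
Qed.

Lemma F4_1_term_sym a b c1 c2 t1 t2 k1 k2 x y m n :
  F4_1_term a b c1 c2 t1 t2 k1 k2 x y m n = F4_1_term b a c1 c2 t1 t2 k1 k2 x y m n.
Proof. unfold F4_1_term. now rewrite (Cmult_comm (poch a (m + n))). Qed.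

Theorem mainTheorem2 (k1 k2 : nat) (a b c1 c2 t1 t2 x y : C)
    (hk1 : (1 <= k1)%nat) (hk2 : (1 <= k2)%nat)
    (hc1 : forall n : nat, Re c1 <> - INR n)
    (hc2 : forall n : nat, Re c2 <> - INR n)
    (hxy : sqrt (Cmod x) + sqrt (Cmod y) < 1)
    (hF : abs_summable2 (F4_1_term a b c1 c2 t1 t2 k1 k2 x y)) :
  (0 < Re a ->
     (forall u : R, 0 < u ->
        abs_summable2 (G_term b c1 c2 t1 t2 k1 k2
                         (scaled_arg k1 u x) (scaled_arg k2 u y))) /\
     ex_CInt0 (G_integrand a b c1 c2 t1 t2 k1 k2 x y) /\
     F4_1 a b c1 c2 t1 t2 k1 k2 x y
     = (RtoC 1 / Gamma a * CInt0 (G_integrand a b c1 c2 t1 t2 k1 k2 x y))%C) /\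
  (0 < Re b ->
     (forall u : R, 0 < u ->
        abs_summable2 (G_term a c1 c2 t1 t2 k1 k2
                         (scaled_arg k1 u x) (scaled_arg k2 u y))) /\
     ex_CInt0 (G_integrand b a c1 c2 t1 t2 k1 k2 x y) /\
     F4_1 a b c1 c2 t1 t2 k1 k2 x y
     = (RtoC 1 / Gamma b * CInt0 (G_integrand b a c1 c2 t1 t2 k1 k2 x y))%C).
Proof.
  split; [now apply F4_1_representation|].
  assert (Hsym : F4_1 a b c1 c2 t1 t2 k1 k2 x y = F4_1 b a c1 c2 t1 t2 k1 k2 x y).
  { apply Csum2_ext. intros m n. apply F4_1_term_sym. }
  rewrite Hsym. apply F4_1_representation; auto.
  apply abs_summable2_le with (2 := hF) (K := 1).
  intros m n. rewrite F4_1_term_sym. lra.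
Qed.
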